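(* The unique symmetric self-dual antinorm on $\mathbb{R}^2_+$ is $f(x,y)=\sqrt{2xy}$.
   Context: $\mathbb{R}^2_+$ is the closed positive quadrant. An antinorm on $\mathbb{R}^2_+$ is a nonnegative, somewhere positive, concave, homogeneous functional $f:\mathbb{R}^2_+\to[0,+\infty)$, where homogeneous means $f(\lambda\boldsymbol{x})=\lambda f(\boldsymbol{x})$ for all $\lambda\ge0$. All antinorms are assumed to be continuous. The dual of an antinorm $f$ is $$f^*(\boldsymbol{p})=\inf_{\boldsymbol{x}\in\mathbb{R}^2_+,\ f(\boldsymbol{x})\ne0}\frac{(\boldsymbol{p},\boldsymbol{x})}{f(\boldsymbol{x})},\qquad \boldsymbol{p}\in\mathbb{R}^2_+,$$ with $(\cdot,\cdot)$ the standard inner product; $f$ is self-dual if $f^*=f$. An antinorm on $\mathbb{R}^2_+$ is symmetric if $f(x,y)=f(y,x)$ for all $(x,y)\in\mathbb{R}^2_+$. *)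

(* Defs.v *)
From HB Require Import structures.
From mathcomp Require Import all_boot all_order all_algebra.
From mathcomp Require Import all_classical all_reals all_analysis.

Set Implicit Arguments.
Unset Strict Implicit.
Unset Printing Implicit Defensive.

Import Order.TTheory GRing.Theory Num.Theory.
Import numFieldNormedType.Exports.

Local Open Scope classical_set_scope.
Local Open Scope ring_scope.

Definition quadrant (R : realType) : set (R * R) :=
  [set x | 0 <= x.1 /\ 0 <= x.2].

Definition inner (R : realType) (p x : R * R) : R := p.1 * x.1 + p.2 * x.2.

(* A functional on the quadrant is encoded as a total function on R * R; only
   its values on the quadrant matter, here and in all definitions below. *)
Record antinorm (R : realType) (f : R * R -> R) : Prop := Antinorm {
  antinorm_ge0 : forall x, quadrant x -> 0 <= f x ;
  antinorm_pos : exists2 x, quadrant x & 0 < f x ;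
  antinorm_concave : forall (t : R) (x y : R * R),
    0 <= t <= 1 -> quadrant x -> quadrant y ->
    t * f x + (1 - t) * f y <= f (t *: x + (1 - t) *: y) ;
  antinorm_homogeneous : forall (l : R) (x : R * R),
    0 <= l -> quadrant x -> f (l *: x) = l * f x ;
  antinorm_continuous : {within @quadrant R, continuous f} }.

(* For an antinorm f and p in the quadrant, the set below is nonempty and
   bounded below by 0, so the real-valued [inf] is the genuine infimum. *)
Definition dual (R : realType) (f : R * R -> R) (p : R * R) : R :=
  inf [set inner p x / f x | x in [set x | quadrant x /\ f x != 0]].

Definition self_dual (R : realType) (f : R * R -> R) : Prop :=
  forall p, quadrant p -> dual f p = f p.

Definition symmetric_on_quadrant (R : realType) (f : R * R -> R) : Prop :=
  forall x y : R, quadrant (x, y) -> f (x, y) = f (y, x).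

(* Main.v *)
Require Import Defs.
From HB Require Import structures.
From mathcomp Require Import all_boot all_order all_algebra.
From mathcomp Require Import all_classical all_reals all_analysis.
From mathcomp Require Import ring lra.

Import Order.TTheory GRing.Theory Num.Theory.
Import numFieldNormedType.Exports.

Local Open Scope classical_set_scope.
Local Open Scope ring_scope.

(** For a nonnegative, somewhere positive [f], the dual satisfies the
    Young-type inequality [dual f p * f x <= inner p x] on the quadrant and is
    the largest functional of [p] that does ([dual_mul_le], [le_dual]).  Let
    [f0 (x, y) = sqrt (2 x y)], written [gm] below.

    Uniqueness.  If [f] is self-dual and symmetric, the inequality at the point
    [(x, y)] and its mirror image [(y, x)] reads [f (x, y) ^ 2 <= 2 x y], that
    is, [f <= f0].  Duality reverses the order, so [f = dual f >= dual f0], and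
    [dual f0 >= f0] by the AM-GM inequality
    [f0 p * f0 x <= inner p x] ([gm_mul_le_inner]); hence [f = f0].

    Self-duality of [f0].  AM-GM gives [f0 <= dual f0].  Equality in AM-GM at
    [p] occurs at the mirror image of [p], where however [f0] vanishes when [p]
    is on the boundary.  Testing with the mirror image of [p + (e, e)] instead
    gives [dual f0 p <= f0 (p + (e, e))], and [e] tends to [0].

    Concavity of [f0] is again AM-GM, applied to [x] and the mirror image of
    [y]. *)

Section Duality.
Context {R : realType}.
Implicit Types (f : R * R -> R) (p x : R * R).

Lemma inner_ge0 p x : quadrant p -> quadrant x -> 0 <= inner p x.
Proof. by move=> [p1 p2] [x1 x2]; rewrite addr_ge0 ?mulr_ge0. Qed.

Lemma dual_mul_le f p x : (forall z, quadrant z -> 0 <= f z) ->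
  quadrant p -> quadrant x -> dual f p * f x <= inner p x.
Proof.
move=> f_ge0 pQ xQ.
have [->|fx_neq0] := eqVneq (f x) 0; first by rewrite mulr0 inner_ge0.
have fx_gt0 : 0 < f x by rewrite lt_def fx_neq0 f_ge0.
rewrite -ler_pdivlMr //; apply: ge_inf; last by exists x.
by exists 0 => _ [z [zQ _] <-]; rewrite divr_ge0 ?inner_ge0 ?f_ge0.
Qed.

Lemma le_dual f p (c : R) : (forall z, quadrant z -> 0 <= f z) ->
  (exists2 x, quadrant x & 0 < f x) ->
  (forall x, quadrant x -> c * f x <= inner p x) -> c <= dual f p.
Proof.
move=> f_ge0 [x0 x0Q fx0_gt0] c_le; apply: lb_le_inf.
  by exists (inner p x0 / f x0), x0 => //; split=> //; rewrite gt_eqF.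
move=> _ [x [xQ fx_neq0] <-]; rewrite ler_pdivlMr ?c_le //.
by rewrite lt_def fx_neq0 f_ge0.
Qed.

End Duality.

Section GeometricMean.
Context {R : realType}.
Implicit Types (p x y : R * R).

(** [sqrt 2] times the geometric mean. *)
Definition gm : R * R -> R := fun v => Num.sqrt (2 * v.1 * v.2).

Lemma gm_ge0 x : 0 <= gm x.
Proof. exact: sqrtr_ge0. Qed.

Lemma gm_sqr x : quadrant x -> gm x ^+ 2 = 2 * x.1 * x.2.
Proof. by move=> [x1 x2]; rewrite sqr_sqrtr ?mulr_ge0. Qed.

Lemma gm_swap (a b : R) : gm (a, b) = gm (b, a).
Proof. by rewrite /gm /= mulrAC. Qed.

Lemma gm_pos : exists2 x : R * R, quadrant x & 0 < gm x.
Proof.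
exists (1, 1); first by split; exact: ler01.
by rewrite sqrtr_gt0 !mulr1.
Qed.

(** AM-GM for the two terms of the inner product, since
    [gm p * gm x = 2 * sqrt ((p.1 * x.1) * (p.2 * x.2))]. *)
Lemma gm_mul_le_inner p x : quadrant p -> quadrant x ->
  gm p * gm x <= inner p x.
Proof.
move=> pQ xQ; rewrite -(ler_pXn2r (n := 2)) ?nnegrE ?inner_ge0 //; last first.
  by rewrite mulr_ge0 ?gm_ge0.
rewrite exprMn !gm_sqr // -subr_ge0.
have -> : inner p x ^+ 2 - 2 * p.1 * p.2 * (2 * x.1 * x.2)
          = (p.1 * x.1 - p.2 * x.2) ^+ 2 by rewrite /inner; ring.
exact: sqr_ge0.
Qed.

(** Expanding both squares, the cross terms compare by AM-GM between [x] and
    the mirror image of [y]. *)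
Lemma gm_superadditive x y : quadrant x -> quadrant y ->
  gm x + gm y <= gm (x + y).
Proof.
move=> xQ yQ; have [x1 x2] := xQ; have [y1 y2] := yQ.
have xyQ : quadrant (x + y) by split; rewrite addr_ge0.
rewrite -(ler_pXn2r (n := 2)) ?nnegrE ?addr_ge0 ?gm_ge0 //.
rewrite sqrrD !gm_sqr //=.
have sQ : quadrant (y.2, y.1) by [].
have := gm_mul_le_inner _ _ xQ sQ; rewrite gm_swap -surjective_pairing.
by rewrite /inner /=; lra.
Qed.

Lemma gm_homogeneous (l : R) x : 0 <= l -> gm (l *: x) = l * gm x.
Proof.
move=> l_ge0; rewrite /gm /=.
have -> : 2 * (l *: x.1) * (l *: x.2) = l ^+ 2 * (2 * x.1 * x.2).
  by rewrite /GRing.scale /=; ring.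
by rewrite sqrtrM ?sqr_ge0 // sqrtr_sqr ger0_norm.
Qed.

Lemma gm_continuous : continuous gm.
Proof.
move=> x; apply: continuous_comp; last exact: sqrt_continuous.
apply: cvgM; last exact: cvg_snd.
by apply: cvgM; [exact: cvg_cst|exact: cvg_fst].
Qed.

Lemma gm_antinorm : antinorm gm.
Proof.
split.
- by move=> x _; exact: gm_ge0.
- exact: gm_pos.
- move=> t x y /andP[t_ge0 t_le1] [x1 x2] [y1 y2].
  have s_ge0 : 0 <= 1 - t by rewrite subr_ge0.
  rewrite -!gm_homogeneous //; apply: gm_superadditive;
    by split; rewrite mulr_ge0.
- by move=> l x l_ge0 _; exact: gm_homogeneous.
- exact/continuous_subspaceT/gm_continuous.
Qed.

(** Here [q = p + (e, e)] and the test point is the mirror image of [q]: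
    there [gm] is positive, and pairing it with [p] gives at most what pairing
    it with [q] gives, namely [gm q ^+ 2]. *)
Lemma dual_gm_le_shift p (e : R) : quadrant p -> 0 < e ->
  dual gm p <= gm (p + (e, e)).
Proof.
move=> pQ e_gt0; have [p1 p2] := pQ.
have q1 : 0 < p.1 + e by rewrite ltr_wpDl.
have q2 : 0 < p.2 + e by rewrite ltr_wpDl.
have qQ : quadrant (p + (e, e)) by split; exact: ltW.
have xQ : quadrant (p.2 + e, p.1 + e) by split; exact: ltW.
have q_gt0 : 0 < gm (p + (e, e)) by rewrite sqrtr_gt0 !mulr_gt0.
rewrite -(ler_pM2r q_gt0) -expr2 gm_sqr //=.
have := dual_mul_le gm p _ (fun z _ => gm_ge0 z) pQ xQ.
rewrite gm_swap => /le_trans; apply; rewrite /inner /=.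
have : 0 <= e * (p.1 + e) by rewrite mulr_ge0 ?ltW.
have : 0 <= e * (p.2 + e) by rewrite mulr_ge0 ?ltW.
by lra.
Qed.

Lemma gm_self_dual : self_dual gm.
Proof.
move=> p pQ; apply/eqP; rewrite eq_le; apply/andP; split; last first.
  by apply: le_dual => [z _||x xQ];
    [exact: gm_ge0|exact: gm_pos|exact: gm_mul_le_inner].
have gm_shift_cvg : gm (p + (e, e)) @[e --> 0^'+] --> gm p.
  have shift_cvg : p + (e, e) @[e --> (0 : R)^'+] --> p + (0, 0).
    apply: cvgD; first exact: cvg_cst.
    apply: (@cvg_pair _ _ _ _ (nbhs (0 : R)) (nbhs (0 : R)));
      exact/cvg_at_right_filter/cvg_id.
  rewrite [p + (0, 0)]addr0 in shift_cvg.
  exact: (cvg_comp _ _ shift_cvg (gm_continuous p)).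
rewrite -(cvg_lim (@Rhausdorff R) gm_shift_cvg).
apply: limr_ge; first by apply/cvg_ex; exists (gm p).
near=> e; apply: dual_gm_le_shift => //.
Unshelve. all: by end_near. Qed.

End GeometricMean.

Section Uniqueness.
Context {R : realType}.
Context (f : R * R -> R) (f_antinorm : antinorm f).
Context (f_sym : symmetric_on_quadrant f) (f_self_dual : self_dual f).

(** Test the infimum defining [dual f v = f v] at the mirror image of [v]: the
    inner product is [2 * v.1 * v.2], and [f] takes the same value at both. *)
Lemma self_dual_symmetric_le_gm v : quadrant v -> f v <= gm v.
Proof.
case: v => x y vQ; have [x_ge0 y_ge0] := vQ.
have sQ : quadrant (y, x) by [].
have f_ge0 := antinorm_ge0 f_antinorm.
rewrite -(ler_pXn2r (n := 2)) ?nnegrE ?f_ge0 ?gm_ge0 // gm_sqr //=.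
have := dual_mul_le f _ _ f_ge0 vQ sQ.
by rewrite f_self_dual // -f_sym // -expr2 /inner /=; lra.
Qed.

(** Duality reverses the bound just obtained, and [gm <= dual gm]. *)
Lemma self_dual_symmetric_ge_gm v : quadrant v -> gm v <= f v.
Proof.
move=> vQ; rewrite -f_self_dual //.
apply: le_dual => [||x xQ]; first exact: antinorm_ge0.
  exact: antinorm_pos.
apply: le_trans (gm_mul_le_inner _ _ vQ xQ).
by rewrite ler_wpM2l ?gm_ge0 ?self_dual_symmetric_le_gm.
Qed.

End Uniqueness.

Theorem theorem5 (R : realType) :
  let f0 : R * R -> R := fun v => Num.sqrt (2 * v.1 * v.2) in
  [/\ antinorm f0, symmetric_on_quadrant f0, self_dual f0 &
      forall f : R * R -> R,
        antinorm f -> symmetric_on_quadrant f -> self_dual f ->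
        forall x y : R, quadrant (x, y) -> f (x, y) = Num.sqrt (2 * x * y)].
Proof.
split; first exact: gm_antinorm.
- by move=> x y _; exact: gm_swap.
- exact: gm_self_dual.
move=> f fA fS fD x y vQ; apply/eqP; rewrite eq_le.
by rewrite (self_dual_symmetric_le_gm _ fA fS fD _ vQ)
  (self_dual_symmetric_ge_gm _ fA fS fD _ vQ).
Qed.
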